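(* Let $\Bbbk$ be a commutative ring and let $R$ be a prime $\Bbbk$-algebra which is finitely generated as a module over its center $\mathcal{Z}(R)$, and assume that $\mathcal{Z}(R)$ is normal. Let $\delta$ be a $\Bbbk$-linear derivation of $R$ such that $\delta(\mathcal{Z}(R))\subseteq\mathcal{Z}(R)$. Then $\mathrm{tr}_{\mathrm{red}}\circ\delta=\delta\circ\mathrm{tr}_{\mathrm{red}}$, where $\mathrm{tr}_{\mathrm{red}}:R\to\mathcal{Z}(R)$ is the reduced trace.
   Context: Algebras are associative and unital. Normal means integrally closed in the field of fractions. Reduced trace: let $Q$ be the fraction field of the integral domain $\mathcal{Z}(R)$. Then $R\otimes_{\mathcal{Z}(R)}Q$ is a central simple $Q$-algebra; choose a finite field extension $F/Q$ with $R\otimes_{\mathcal{Z}(R)}F\cong M_n(F)$. The reduced trace is the composition $R\hookrightarrow R\otimes_{\mathcal{Z}(R)}Q\to R\otimes_{\mathcal{Z}(R)}F\cong M_n(F)\to F$ with last map the matrix trace; it takes values in $Q$, is independent of choices, and takes values in $\mathcal{Z}(R)$ when $\mathcal{Z}(R)$ is normal. *)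

(* Defs.v *)
From HB Require Import structures.
From mathcomp Require Import all_boot all_algebra all_field.
From mathcomp Require Import boolp.

Set Implicit Arguments.
Unset Strict Implicit.
Unset Printing Implicit Defensive.

Import GRing.Theory.
Local Open Scope ring_scope.

(* The zero ring is excluded by the nzRingType structure. *)
Definition prime_ring (R : nzRingType) : Prop :=
  forall a b : R, (forall r : R, a * r * b = 0) -> a = 0 \/ b = 0.

Definition central (R : nzRingType) : {pred R} :=
  fun x => `[< forall y : R, x * y = y * x >].

Lemma centralP (R : nzRingType) (x : R) :
  reflect (forall y : R, x * y = y * x) (x \in @central R).
Proof. exact: asboolP. Qed.

Fact central_subring (R : nzRingType) : subring_closed (@central R).
Proof.
split=> [|x y /centralP cx /centralP cy|x y /centralP cx /centralP cy];
  apply/centralP=> z.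
- by rewrite mul1r mulr1.
- by rewrite mulrBl mulrBr cx cy.
- by rewrite -mulrA cy mulrA cx mulrA.
Qed.

HB.instance Definition _ (R : nzRingType) :=
  GRing.isSubringClosed.Build R (@central R) (@central_subring R).

Record center (R : nzRingType) :=
  Center { center_val : R; center_valP : center_val \in @central R }.

HB.instance Definition _ (R : nzRingType) := [isSub for @center_val R].
HB.instance Definition _ (R : nzRingType) := [Choice of center R by <:].
HB.instance Definition _ (R : nzRingType) :=
  [SubChoice_isSubNzRing of center R by <:].

Fact center_mulC (R : nzRingType) : commutative (@GRing.mul (center R)).
Proof.
move=> x y; apply: val_inj; rewrite !rmorphM /=.
by have /centralP -> := valP x.
Qed.

HB.instance Definition _ (R : nzRingType) :=
  GRing.PzRing_hasCommutativeMul.Build (center R) (@center_mulC R).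

Section CenterInverse.
Variable R : nzRingType.
Implicit Types x y : center R.

Definition center_unit : {pred center R} := fun x => `[< exists y, y * x = 1 >].

Definition center_inv x : center R :=
  if pselect (exists y, y * x = 1) is left e then projT1 (cid e) else x.

Fact center_mulVx : {in center_unit, left_inverse 1 center_inv *%R}.
Proof.
move=> x /asboolP ex; rewrite /center_inv.
by case: pselect => // e; case: (cid e).
Qed.

Fact center_unitPl x y : y * x = 1 -> center_unit x.
Proof. by move=> yx1; apply/asboolP; exists y. Qed.

Fact center_inv_out : {in [predC center_unit], center_inv =1 id}.
Proof. by move=> x /asboolP nex; rewrite /center_inv; case: pselect. Qed.

HB.instance Definition _ := GRing.ComNzRing_hasMulInverse.Build (center R)
  center_mulVx center_unitPl center_inv_out.
End CenterInverse.

(* An alias of [center R] that carries the integral domain structure, which is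
   only available once R is known to be prime. *)
Definition center_domain (R : nzRingType) (hR : prime_ring R) : Type := center R.

Section CenterDomain.
Variables (R : nzRingType) (hR : prime_ring R).

HB.instance Definition _ :=
  GRing.ComUnitRing.copy (center_domain hR) (center R).

Fact center_integral : GRing.integral_domain_axiom (center_domain hR).
Proof.
move=> x y /(congr1 val) xy0.
have [r|x0|y0] := hR (a := val (x : center R)) (b := val (y : center R)).
- have -> : val (x : center R) * r * val (y : center R)
          = val (x : center R) * val (y : center R) * r.
    by rewrite -!mulrA; have /centralP -> := valP (y : center R).
  by have -> : val (x : center R) * val (y : center R) = 0; [exact: xy0 | rewrite mul0r].
- by apply/orP; left; apply/eqP/val_inj.
- by apply/orP; right; apply/eqP/val_inj.
Qed.

HB.instance Definition _ :=
  GRing.ComUnitRing_isIntegral.Build (center_domain hR) center_integral.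
End CenterDomain.

Definition finite_over_center (R : nzRingType) : Prop :=
  exists (m : nat) (e : 'I_m -> R), forall x : R,
    exists c : 'I_m -> center R, x = \sum_(i < m) val (c i) * e i.

Definition normal_domain (Z : idomainType) : Prop :=
  forall q : {fraction Z},
    integralOver (@tofrac Z) q -> exists z : Z, q = tofrac z.

Section TensorProduct.
Variables (Z A B : nzRingType) (i : Z -> A) (j : Z -> B).

Definition balanced (W : zmodType) (b : A -> B -> W) : Prop :=
  [/\ forall x x' y, b (x + x') y = b x y + b x' y,
      forall x y y', b x (y + y') = b x y + b x y'
    & forall z x y, b (x * i z) y = b x (j z * y)].

(* The abelian group T, with pure tensors [t x y], is the tensor product of
   the right Z-module A and the left Z-module B. *)
Definition is_tensor_product (T : zmodType) (t : A -> B -> T) : Prop :=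
  balanced t /\
  forall (W : zmodType) (b : A -> B -> W), balanced b ->
    (exists g : {additive T -> W}, forall x y, g (t x y) = b x y) /\
    (forall g g' : {additive T -> W},
       (forall x y, g (t x y) = g' (t x y)) -> g =1 g').
End TensorProduct.

Section ReducedTrace.
Variables (R : nzRingType) (hR : prime_ring R).

Local Notation Q := {fraction center_domain hR}.

Definition center_to_ext (F : fieldExtType Q) (z : center R) : F :=
  (tofrac (z : center_domain hR))%:A.

(* T, with pure tensors [t r c], is the F-algebra obtained from R by extending
   scalars from its center to F. *)
Definition is_scalar_extension (F : fieldExtType Q) (T : algType F)
    (t : R -> F -> T) : Prop :=
  [/\ is_tensor_product (val : center R -> R) (center_to_ext F) t,
      t 1 1 = 1,
      forall r s c d, t r c * t s d = t (r * s) (c * d)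
    & forall a r c, a *: t r c = t r (a * c)].

(* A fieldExtType is finite dimensional, so F ranges over the finite
   extensions of Q; the size n.+1 loses nothing as T is a nonzero ring. The
   reduced trace is given as a relation because it depends a priori on the
   splitting (F, T, t, phi). *)
Definition is_reduced_trace (tr : R -> center R) : Prop :=
  exists (F : fieldExtType Q) (T : algType F) (t : R -> F -> T)
         (n : nat) (phi : {lrmorphism T -> 'M[F]_n.+1}),
    [/\ is_scalar_extension t,
        bijective phi
      & forall r : R, center_to_ext F (tr r) = \tr (phi (t r 1))].
End ReducedTrace.

Definition derivation (k : pzRingType) (R : algType k)
    (delta : {linear R -> R}) : Prop :=
  forall x y : R, delta (x * y) = delta x * y + x * delta y.

(* Main.v *)
(* The map D := tr o delta - delta o tr is linear over the center and kills
   commutators, so it extends to a tracial linear form on the split algebra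
   'M_n(F), whence D = c tr for some c in F. If n is nonzero in F then D 1 = 0
   gives c n = 0. Otherwise F has characteristic p > 0, where
   tr (r ^+ p) = tr r ^+ p and both terms of D (r ^+ p) are multiples of p, so
   c (tr r)^p = 0 for all r, while tr is nonzero. In particular delta need not
   extend to F, which may be inseparable over the field of fractions. *)

Require Import Defs.
From HB Require Import structures.
From mathcomp Require Import all_boot all_algebra all_field.

Import GRing.Theory.
Local Open Scope ring_scope.

(** * Frobenius and tracial forms on matrices *)

Lemma pFrobenius_poly (R : comNzRingType) (p : nat) (pR : p \in [pchar R])
    (q : {poly R}) :
  q ^+ p = map_poly (pFrobenius_aut pR) q \Po 'X^p.
Proof.
have pRX : p \in [pchar {poly R}] by rewrite (rmorph_pchar polyC).
rewrite -(pFrobenius_autE pRX).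
elim/poly_ind: q => [|q c IHq]; first by rewrite !raddf0.
rewrite !rmorphD !rmorphM /= IHq map_polyC map_polyX /= comp_polyX comp_polyC.
by rewrite !pFrobenius_autE rmorphXn.
Qed.

Section PrimeCharacteristic.
Variables (F : fieldType) (p : nat) (pF : p \in [pchar F]).

(* [det (t^p - A^p) = det (t - A)^p], as t and A commute in characteristic p. *)
Lemma char_poly_pFrobenius n (A : 'M[F]_n.+1) :
  char_poly (A ^+ p) \Po 'X^p = char_poly A ^+ p.
Proof.
have pM : p \in [pchar 'M[{poly F}]_n.+1].
  by rewrite (rmorph_pchar (@scalar_mx _ _)) // (rmorph_pchar polyC).
have detX (B : 'M[{poly F}]_n.+1) m : \det (B ^+ m) = \det B ^+ m.
  by elim: m => [|m IHm]; rewrite ?det1 // !exprS det_mulmx IHm.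
rewrite /char_poly -[RHS]detX -(pFrobenius_autE pM).
rewrite pFrobenius_autB_comm; last exact: comm_scalar_mx.
rewrite -[LHS]/(comp_poly _ _) -det_map_mx !pFrobenius_autE; congr (\det _).
rewrite /char_poly_mx map_mxB map_scalar_mx /= comp_polyX.
rewrite -!rmorphXn /=; congr (_ - _).
by apply/matrixP=> i j; rewrite !mxE comp_polyC.
Qed.

(** Compare the coefficients of degree [n * p] in [char_poly_pFrobenius]. Frobenius is additive, so
    the sign passes through it even when p = 2. *)
Lemma mxtrace_pFrobenius n (A : 'M[F]_n.+1) : \tr (A ^+ p) = \tr A ^+ p.
Proof.
have p0 := prime_gt0 (pcharf_prime pF).
have /(congr1 (fun q : {poly F} => q`_(n * p))) := char_poly_pFrobenius _ A.
rewrite (pFrobenius_poly _ _ pF (char_poly A)) !coef_comp_poly_Xn //.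
rewrite dvdn_mull // mulnK //.
have coefn B := @char_poly_trace F n.+1 B isT.
rewrite coef_map !coefn raddfN /= pFrobenius_autE.
by move=> /oppr_inj.
Qed.
End PrimeCharacteristic.

(** Writing E_ij = E_i0 E_0j and swapping the factors gives E_0j E_i0, which is E_00 if i = j and 0
    otherwise. *)
Lemma mxtrace_unique (F : comNzRingType) n (f : {scalar 'M[F]_n.+1}) :
    (forall A B, f (A *m B) = f (B *m A)) ->
  forall A, f A = f (delta_mx ord0 ord0) * \tr A.
Proof.
move=> fC A; rewrite {1}[A]matrix_sum_delta linear_sum mulr_sumr.
apply: eq_bigr => i _; rewrite linear_sum (bigD1 i) //= big1 => [|j ji].
  rewrite addr0 linearZ /= mulrC; congr (_ * _).
  by rewrite -(mul_delta_mx (ord0 : 'I_n.+1)) fC mul_delta_mx.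
rewrite linearZ /= -(mul_delta_mx (ord0 : 'I_n.+1)) fC mul_delta_mx_cond.
by rewrite (negPf ji) linear0 mulr0.
Qed.

Section CenterToExt.
Variables (R : nzRingType) (hR : prime_ring R).
Variable F : fieldExtType {fraction center_domain hR}.
Local Notation iota := (@center_to_ext R hR F).

Lemma center_to_ext_zmod_morphism : zmod_morphism iota.
Proof.
move=> x y; rewrite /center_to_ext -scalerBl.
by rewrite -(rmorphB (@tofrac (center_domain hR))).
Qed.

Lemma center_to_ext_monoid_morphism : monoid_morphism iota.
Proof.
rewrite /center_to_ext; split=> [|x y].
  by rewrite (rmorph1 (@tofrac (center_domain hR))) scale1r.
rewrite -scalerAl mul1r scalerA.
by rewrite -(rmorphM (@tofrac (center_domain hR))).
Qed.

HB.instance Definition _ :=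
  GRing.isZmodMorphism.Build _ _ iota center_to_ext_zmod_morphism.
HB.instance Definition _ :=
  GRing.isMonoidMorphism.Build _ _ iota center_to_ext_monoid_morphism.

Lemma center_to_ext_inj : injective iota.
Proof.
apply: raddf_inj => x /eqP; rewrite /center_to_ext scaler_eq0 oner_eq0 orbF.
by rewrite tofrac_eq0 => /eqP.
Qed.
End CenterToExt.

(** * Derivations and traces of powers *)

Section Derivation.
Variables (R : nzRingType) (delta : {additive R -> R}).
Hypothesis deltaM : forall x y, delta (x * y) = delta x * y + x * delta y.

Lemma derivation1 : delta 1 = 0.
Proof.
by apply: (addrI (delta 1)); rewrite addr0 -{3}[1]mulr1 deltaM mul1r mulr1.
Qed.

Lemma trace_derivation_exp (V : zmodType) (tau : {additive R -> V}) :
    (forall x y, tau (x * y) = tau (y * x)) ->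
  forall x m, tau (delta (x ^+ m.+1)) = tau (x ^+ m * delta x) *+ m.+1.
Proof.
(* Leibniz leaves a power of [x] to the left of [delta], so the induction on [m] carries an
   arbitrary factor [x ^+ j]. *)
move=> tauC x m; suff H j : tau (x ^+ j * delta (x ^+ m.+1))
    = tau (x ^+ (j + m) * delta x) *+ m.+1 by have := H 0; rewrite mul1r.
elim: m j => [|m IHm] j; first by rewrite addn0.
rewrite exprS deltaM mulrDr raddfD /= [x ^+ j * (x * _)]mulrA -exprSr IHm.
rewrite addSnnS [RHS]mulrS.
by congr (_ + _); rewrite mulrA tauC mulrA -exprD addnC.
Qed.

End Derivation.

(** * Linear forms on the scalar extension *)

Section ScalarExtension.
Variables (R : nzRingType) (hR : prime_ring R).
Variable F : fieldExtType {fraction center_domain hR}.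
Variables (T : algType F) (t : R -> F -> T) (hT : is_scalar_extension t).
Local Notation iota := (@center_to_ext R hR F).

Lemma pure_tensor_ext (W : zmodType) (f g : {additive T -> W}) :
  (forall r c, f (t r c) = g (t r c)) -> f =1 g.
Proof.
case: hT => [[t_bal t_univ] _ _ _].
(* Uniqueness in [is_tensor_product] is only available for a [W] that receives a balanced map; [f]
   supplies one. *)
pose b r c := f (t r c).
have b_bal : balanced (val : center R -> R) iota b.
  case: t_bal => tD1 tD2 tA; split=> *; rewrite /b.
  - by rewrite tD1 raddfD.
  - by rewrite tD2 raddfD.
  - by rewrite tA.
by have [_] := t_univ _ _ b_bal; apply.
Qed.

Lemma scalar_extension_lift (f : {additive R -> F}) :
    (forall r z, f (r * val z) = iota z * f r) ->
  exists g : {scalar T}, forall r c, g (t r c) = f r * c.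
Proof.
move=> fZ; have [[t_bal t_univ] _ _ tZ] := hT.
pose b r c := f r * c.
have b_bal : balanced (val : center R -> R) iota b.
  split=> *; rewrite /b; first by rewrite raddfD mulrDl.
    by rewrite mulrDr.
  by rewrite fZ mulrA [_ * f _]mulrC.
have [[g gE] _] := t_univ _ _ b_bal.
(* The universal property yields only an additive [g]; linearity over [F] is checked on pure
   tensors. *)
have gZ : scalable_for *%R g.
  move=> a; apply: (pure_tensor_ext _ (g \o ( *:%R a)) (a \*o g)) => r c /=.
  by rewrite tZ !gE /b mulrCA.
have g_linear : linear_for *%R g by move=> a x y; rewrite raddfD gZ.
pose gL := HB.pack_for {scalar T} (GRing.Additive.sort g)
  (GRing.isLinear.Build F T F *%R (GRing.Additive.sort g) g_linear).
by exists gL.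
Qed.

Lemma scalar_extension_tracial (g : {scalar T}) :
    (forall r s, g (t (r * s) 1) = g (t (s * r) 1)) ->
  forall x y, g (x * y) = g (y * x).
Proof.
have [_ _ tM tZ] := hT => gC x y.
have tC r c : t r c = c *: t r 1 by rewrite tZ mulr1.
(* Reduce to pure tensors one factor at a time: first [y], then [x]. *)
apply: (pure_tensor_ext _ (g \o (x \*o idfun)) (g \o (x \o* idfun))) => s d /=.
apply: (pure_tensor_ext _ (g \o (t s d \o* idfun))
  (g \o (t s d \*o idfun))) => r c /=.
by rewrite !tM [d * c]mulrC [t (r * s) _]tC [t (s * r) _]tC !linearZ /= gC.
Qed.

Lemma pure_tensorM z r : t (r * val z) 1 = iota z *: t r 1.
Proof. by case: hT => [[[_ _ tA] _] _ _ tZ]; rewrite tA tZ. Qed.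

End ScalarExtension.

(** * The reduced trace and the derivation *)

Section ReducedTraceDerivation.
Variables (R : nzRingType) (hR : prime_ring R) (delta : {additive R -> R}).
Hypothesis deltaM : forall x y, delta (x * y) = delta x * y + x * delta y.
Hypothesis delta_central :
  forall x : R, x \in @central R -> delta x \in @central R.

Definition center_derivation (z : center R) : center R :=
  Center (delta_central _ (valP z)).

Lemma center_derivation_zmod_morphism : zmod_morphism center_derivation.
Proof. by move=> x y; apply: val_inj; rewrite /= !raddfB. Qed.

HB.instance Definition _ := GRing.isZmodMorphism.Build _ _ center_derivation
  center_derivation_zmod_morphism.

Lemma center_derivationM z w : center_derivation (z * w)
  = center_derivation z * w + z * center_derivation w.
Proof. by apply: val_inj; rewrite rmorphD !rmorphM /= -deltaM. Qed.

Lemma reduced_trace_derivation (tr : R -> center R) :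
  is_reduced_trace hR tr -> forall x, val (tr (delta x)) = delta (val (tr x)).
Proof.
case=> F [T [t [n [phi [hT phi_bij trE]]]]].
have [[[tD _ _] _] t11 tM tZ] := hT.
(* [tr] is a bare function: its additivity, symmetry and linearity over the center are pulled back
   from the matrix trace along the injective [center_to_ext]. *)
have tr_zmod : zmod_morphism tr.
  have trD x y : tr (x + y) = tr x + tr y.
    apply: (@center_to_ext_inj _ hR F).
    by rewrite raddfD /= !trE tD !raddfD.
  by move=> x y; apply: (addIr (tr y)); rewrite -trD !subrK.
pose trA := HB.pack_for {additive R -> center R} tr
  (GRing.isZmodMorphism.Build R (center R) tr tr_zmod).
pose iota := @center_to_ext R hR F.
have trMC x y : tr (x * y) = tr (y * x).
  apply: (@center_to_ext_inj _ hR F).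
  by rewrite !trE -[1]mulr1 -!tM !rmorphM /= mxtrace_mulC.
have trZ x z : tr (x * val z) = z * tr x.
  apply: (@center_to_ext_inj _ hR F).
  by rewrite rmorphM /= !trE (pure_tensorM _ _ _ _ _ hT) linearZ /= mxtraceZ.
pose D x := iota (tr (delta x) - center_derivation (tr x)).
have D_zmod : zmod_morphism D.
  move=> x y; rewrite /D -raddfB /=; congr (iota _).
  rewrite raddfB !tr_zmod [center_derivation _]raddfB !opprD !opprK.
  by rewrite addrACA.
pose DA := HB.pack_for {additive R -> F} D
  (GRing.isZmodMorphism.Build R F D D_zmod).
(* By Leibniz both terms of [D] contribute [center_derivation z * tr r], which cancels. *)
have DZ r z : D (r * val z) = iota z * D r.
  rewrite /D -rmorphM /=; congr (iota _).
  rewrite deltaM [tr _](raddfD trA) /= !trZ.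
  rewrite -[delta (val z)]/(val (center_derivation z)).
  by rewrite trZ center_derivationM opprD addrA addrK -mulrBr.
have [g gE] := scalar_extension_lift _ _ _ _ _ hT DA DZ.
have gC : forall x y, g (x * y) = g (y * x).
  apply: (scalar_extension_tracial _ _ _ _ _ hT) => x y.
  rewrite !gE /= !mulr1 /D [tr (x * y)]trMC; congr (iota (_ - _)).
  rewrite !deltaM ![tr _](raddfD trA) /= [LHS]addrC.
  by congr (_ + _); apply: trMC.
have [psi phiK psiK] := phi_bij.
(* [psi] is only a set-theoretic inverse; its linearity and multiplicativity follow from injectivity
   of [phi]. *)
have f_linear : linear_for *%R (g \o psi).
  move=> a A B /=.
  suff -> : psi (a *: A + B) = a *: psi A + psi B by rewrite linearP.
  by apply: (can_inj phiK); rewrite linearP /= !psiK.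
pose f := HB.pack_for {scalar 'M[F]_n.+1} (g \o psi)
  (GRing.isLinear.Build F 'M[F]_n.+1 F *%R (g \o psi) f_linear).
have fC A B : f (A *m B) = f (B *m A).
  have psiM A' B' : psi (A' *m B') = psi A' * psi B'.
    by apply: (can_inj phiK); rewrite rmorphM /= !psiK.
  by rewrite /= !psiM gC.
pose c := f (delta_mx ord0 ord0).
have DE r : D r = c * iota (tr r).
  by rewrite -[D r]mulr1 -[D r]/(DA r) -gE /iota trE -mxtrace_unique //= phiK.
suff c0 : c = 0.
  move=> x; have := DE x; rewrite c0 mul0r => /eqP.
  rewrite raddf_eq0; last exact: center_to_ext_inj.
  by rewrite subr_eq0 => /eqP ->.
have cd1 : center_derivation 1 = 0 by exact: derivation1 center_derivationM.
have tr1 : tr 1 = n.+1%:R.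
  apply: (@center_to_ext_inj _ hR F).
  by rewrite trE t11 rmorph1 mxtrace1 rmorph_nat.
(* If the matrix size vanishes in [F], this provides the characteristic p; otherwise [D 1 = 0]
   already forces [c = 0]. *)
have [/eqP/natf0_pchar [] // p pF|n0] := eqVneq (n.+1%:R : F) 0; last first.
  have := DE 1; rewrite /D derivation1 // [tr 0](raddf0 trA) tr1 raddfMn /= cd1.
  rewrite mul0rn subr0 /iota raddf0 rmorph_nat => /esym/eqP.
  by rewrite mulf_eq0 (negPf n0) orbF => /eqP.
have trX r : tr (r ^+ p) = tr r ^+ p.
  apply: (@center_to_ext_inj _ hR F).
  rewrite rmorphXn /= !trE -(mxtrace_pFrobenius _ _ pF) -rmorphXn.
  congr (\tr (phi _)).
  elim: (p) => [|m IHm]; first by rewrite t11.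
  by rewrite !exprS -IHm tM mulr1.
have DX r : D (r ^+ p) = 0.
  (* With p = m + 1, both terms of [D (r ^+ p)] are p-fold sums by [trace_derivation_exp], the
     second with the identity of the center as trace. *)
  case: p pF trX => [/pcharf_prime//|m] pF trX.
  rewrite /D trX [tr _](trace_derivation_exp _ _ deltaM _ trA trMC).
  rewrite [center_derivation _]
    (trace_derivation_exp _ _ center_derivationM _ idfun (@mulrC _)) /=.
  by rewrite -mulrnBl /iota raddfMn /= mulrn_pchar.
apply/eqP/negPn/negP => c0.
have tr0 r : tr r = 0.
  apply: (@center_to_ext_inj _ hR F); apply/eqP; have := DX r.
  rewrite DE trX /iota rmorphXn /= => /eqP.
  rewrite mulf_eq0 (negPf c0) expf_eq0 prime_gt0 ?(pcharf_prime pF) //.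
  by rewrite raddf0.
(* If [tr] vanishes, so does the matrix trace on the image of [phi], which is everything; but E_00
   has trace 1. *)
have tr_phi0 : @mxtrace F n.+1 \o phi =1 \0%R.
  apply: (pure_tensor_ext _ _ _ _ _ hT) => r d /=.
  by rewrite -[d]mulr1 -tZ linearZ /= mxtraceZ -trE tr0 raddf0 mulr0.
have /= := tr_phi0 (psi (delta_mx ord0 ord0)).
rewrite psiK /mxtrace (bigD1 ord0) //= big1 => [|i i0]; last first.
  by rewrite mxE (negPf i0).
by rewrite mxE addr0 => /eqP; rewrite oner_eq0.
Qed.
End ReducedTraceDerivation.

Theorem theorem3p2 (k : comPzRingType) (R : algType k) (hR : prime_ring R)
    (hfin : finite_over_center R)
    (hnormal : normal_domain (center_domain hR))
    (delta : {linear R -> R}) (hdelta : derivation delta)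
    (hZ : forall x : R, x \in @central R -> delta x \in @central R)
    (tr_red : R -> center R) (htr : is_reduced_trace hR tr_red) :
  forall x : R, val (tr_red (delta x)) = delta (val (tr_red x)).
Proof. exact: reduced_trace_derivation hdelta hZ _ htr. Qed.
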